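(* In three spacetime dimensions define, for every integer $n\ge1$, $$\mathcal{C}_{(n)}=\frac{3(-1)^n}{4\cdot6^n n}\Big\{(R+\sqrt{24\mathcal{S}_2})^{n-1}\big(R-(n-1)\sqrt{24\mathcal{S}_2}\big)\Big(1-\sqrt6\frac{\mathcal{S}_3}{\mathcal{S}_2^{3/2}}\Big)+(R-\sqrt{24\mathcal{S}_2})^{n-1}\big(R+(n-1)\sqrt{24\mathcal{S}_2}\big)\Big(1+\sqrt6\frac{\mathcal{S}_3}{\mathcal{S}_2^{3/2}}\Big)\Big\}.$$ Then: (i) $\mathcal{C}_{(n)}$ is a polynomial of curvature order $n$ in $R,\mathcal{S}_2,\mathcal{S}_3$, namely $$\mathcal{C}_{(n)}=\frac{3(-1)^n}{2\cdot6^nn}\Big\{\sum_{k=0}^{\lfloor n/2\rfloor}(24\mathcal{S}_2)^kR^{n-2k}\Big[\tbinom{n-1}{2k}-(n-1)\tbinom{n-1}{2k-1}\Big]-288\,\mathcal{S}_3\sum_{k=0}^{\lfloor(n-3)/2\rfloor}(24\mathcal{S}_2)^kR^{n-3-2k}\Big[\tbinom{n-1}{2k+3}-(n-1)\tbinom{n-1}{2k+2}\Big]\Big\}.$$ (ii) On the metric $ds^2=dr^2+a(r)^2(-dt^2+dx^2)$ it evaluates to $$\mathcal{C}_{(n)}\big|_a=\Big(\frac{a'}{a}\Big)^{2(n-1)}\Big[\frac{a''}{a}+\frac{3-2n}{2n}\Big(\frac{a'}{a}\Big)^2\Big].$$ (iii) For all $n\ge4$, $$\mathcal{C}_{(n)}=\frac{4(n-1)(n-2)}{3n(n-3)}\Big(\mathcal{C}_{(n-1)}\mathcal{C}_{(1)}-\mathcal{C}_{(n-2)}\mathcal{C}_{(2)}\Big),$$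 with $\mathcal{C}_{(1)}=-\frac R4$, $\mathcal{C}_{(2)}=\frac{R^2}{48}-\frac{\mathcal{S}_2}{2}$, $\mathcal{C}_{(3)}=-\frac{R^3}{432}+\frac{R\mathcal{S}_2}{6}-\frac{4\mathcal{S}_3}{3}$.
   Context: $R_{\langle ab\rangle}=R_{ab}-\frac13g_{ab}R$ is the traceless Ricci tensor, $\mathcal{S}_2=R_{\langle a}{}^{b\rangle}R_{\langle b}{}^{a\rangle}$, $\mathcal{S}_3=R_{\langle a}{}^{b\rangle}R_{\langle b}{}^{c\rangle}R_{\langle c}{}^{a\rangle}$. A monomial $R^i\mathcal{S}_2^j\mathcal{S}_3^k$ has curvature order $i+2j+3k$. Binomial coefficients $\binom{m}{l}$ vanish for $l<0$ or $l>m$, and sums with upper limit smaller than the lower limit are zero. On the metric of (ii), $R|_a=-\frac{2(a'^2+2aa'')}{a^2}$, $\mathcal{S}_2|_a=\frac{2(a'^2-aa'')^2}{3a^4}$, $\mathcal{S}_3|_a=\frac{2(a'^2-aa'')^3}{9a^6}$. *)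

(* Defs.v *)
From HB Require Import structures.
From mathcomp Require Import all_boot all_order all_algebra.
From mathcomp Require Import complex.
From mathcomp Require Import all_classical all_reals all_analysis.
Import numFieldNormedType.Exports.

Set Implicit Arguments.
Unset Strict Implicit.
Unset Printing Implicit Defensive.

Import Order.TTheory GRing.Theory Num.Theory.
Local Open Scope ring_scope.
Local Open Scope complex_scope.
Local Open Scope classical_set_scope.

Section Curvature.
Variable R : realType.

(* A metric in a coordinate patch of a 3-dimensional spacetime: the component
   matrix g_ab as a function of the coordinates. *)
Implicit Types (g : 'rV[R]_3 -> 'M[R]_3) (p : 'rV[R]_3) (a b c d : 'I_3).

Definition pderiv a (f : 'rV[R]_3 -> R) p : R := 'D_(delta_mx 0 a) f p.

(* christoffel g c a b = Gamma^c_ab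
     = 1/2 g^cd (d_a g_db + d_b g_da - d_d g_ab) *)
Definition christoffel g c a b p : R :=
  2^-1 * \sum_d invmx (g p) c d *
    (pderiv a (fun q => g q d b) p + pderiv b (fun q => g q d a) p
     - pderiv d (fun q => g q a b) p).

(* riemann g c d a b = R^c_dab, with the convention
     R^c_dab = d_a Gamma^c_bd - d_b Gamma^c_ad
             + Gamma^c_ae Gamma^e_bd - Gamma^c_be Gamma^e_ad,
   for which spheres have positive scalar curvature. *)
Definition riemann g c d a b p : R :=
  pderiv a (christoffel g c b d) p - pderiv b (christoffel g c a d) p
  + \sum_e (christoffel g c a e p * christoffel g e b d p
            - christoffel g c b e p * christoffel g e a d p).

(* R_ab = R^c_acb *)
Definition ricci g p : 'M[R]_3 := \matrix_(a, b) \sum_c riemann g c a c b p.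

Definition scalar_curvature g p : R := \tr (ricci g p *m invmx (g p)).

Definition traceless_ricci g p : 'M[R]_3 :=
  ricci g p - (3^-1 * scalar_curvature g p) *: g p.

(* The entry (a, b) is R_<a>^b: the second index is raised with g^-1. *)
Definition mixed_traceless_ricci g p : 'M[R]_3 :=
  traceless_ricci g p *m invmx (g p).

Definition curvS2 g p : R :=
  \sum_a \sum_b mixed_traceless_ricci g p a b * mixed_traceless_ricci g p b a.

Definition curvS3 g p : R :=
  \sum_a \sum_b \sum_c mixed_traceless_ricci g p a b
    * mixed_traceless_ricci g p b c * mixed_traceless_ricci g p c a.

(* ds^2 = dr^2 + w(r)^2 (- dt^2 + dx^2), in the coordinates (r, t, x). *)
Definition warped_metric (w : R -> R) p : 'M[R]_3 :=
  diag_mx (\row_(i < 3) [:: 1; - w (p 0 0) ^+ 2; w (p 0 0) ^+ 2]`_i).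

End Curvature.

Section Invariants.
Variable R : realType.

(* In Lorentzian signature S_2 may be negative, so the square roots are taken
   in R[i] (principal branch), with S_2^(3/2) read as (sqrt S_2)^3. This
   expression is meaningful only for s2 != 0: at s2 = 0 the quotient below is
   the conventional value 0. *)
Definition C_closed (n : nat) (rho s2 s3 : R) : R[i] :=
  let x := sqrtC (24 * s2%:C) in
  let y := sqrtC 6 * (s3%:C / sqrtC s2%:C ^+ 3) in
  3 * (-1) ^+ n / (4 * 6 ^+ n * n%:R) *
  ((rho%:C + x) ^+ n.-1 * (rho%:C - n.-1%:R * x) * (1 - y)
   + (rho%:C - x) ^+ n.-1 * (rho%:C + n.-1%:R * x) * (1 + y)).

(* Binomial coefficient with an integer lower entry, zero when l < 0: natural
   number subtraction would turn the lower entry 2k - 1 into 0 at k = 0. *)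
Definition binz (m : nat) (l : int) : R :=
  if l is Posz j then 'C(m, j)%:R else 0.

(* The second sum has floor((n - 3) / 2) + 1 = floor((n - 1) / 2) terms; it is
   empty for n = 1, 2. The natural number subtractions in the exponents are
   never truncated on the ranges of summation. *)
Definition C_poly (n : nat) (rho s2 s3 : R) : R :=
  3 * (-1) ^+ n / (2 * 6 ^+ n * n%:R) *
  (\sum_(0 <= k < n./2.+1) (24 * s2) ^+ k * rho ^+ (n - 2 * k) *
      (binz n.-1 ((2 * k)%:Z) - n.-1%:R * binz n.-1 ((2 * k)%:Z - 1))
   - 288 * s3 *
     \sum_(0 <= k < n.-1./2) (24 * s2) ^+ k * rho ^+ (n - 3 - 2 * k) *
      (binz n.-1 ((2 * k + 3)%:Z) - n.-1%:R * binz n.-1 ((2 * k + 2)%:Z))).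

(* f is a polynomial in R, S_2, S_3 all of whose monomials R^i S_2^j S_3^k have
   curvature order i + 2j + 3k = n. *)
Definition polynomial_of_order (n : nat) (f : R -> R -> R -> R) : Prop :=
  exists c : nat -> nat -> nat -> R, forall rho s2 s3,
    f rho s2 s3 =
    \sum_(i < n.+1) \sum_(j < n.+1) \sum_(k < n.+1 | (i + 2 * j + 3 * k == n)%N)
      c i j k * rho ^+ i * s2 ^+ j * s3 ^+ k.

End Invariants.

(* Main.v *)
(* Put x^2 = 24 S_2 and F_n(x) = (R + x)^(n-1) (R - (n-1) x). The coefficient
   of x in F_n vanishes, so F_n(x) = E_n(x^2) + x^3 O_n(x^2), and
   sqrt 6 S_3 / S_2^(3/2) = 288 S_3 / x^3 turns the closed form into a multiple
   of E_n - 288 S_3 O_n, which is the polynomial of (i).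
   On the warped metric the mixed traceless Ricci tensor is
   diag (2u/3, -u/3, -u/3) with u = (a'/a)^2 - a''/a, so that 24 S_2 = x^2 and
   288 S_3 = x^3 for x = 4u; the polynomial then collapses to a multiple of
   F_n(-x), also where S_2 = 0.
   The recursion is a rational identity between closed forms for S_2 != 0, and
   extends to S_2 = 0 because both sides are polynomials in S_2. *)

Require Import Defs.
From HB Require Import structures.
From mathcomp Require Import all_boot all_order all_algebra.
From mathcomp Require Import complex.
From mathcomp Require Import all_classical all_reals all_analysis.
From mathcomp Require Import ring zify.
Import numFieldNormedType.Exports.
Import Order.TTheory GRing.Theory Num.Theory.
Local Open Scope ring_scope.
Local Open Scope complex_scope.
Local Open Scope classical_set_scope.

Set Implicit Arguments.
Unset Strict Implicit.
Unset Printing Implicit Defensive.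

(** * Even and odd parts of the generating polynomial, and the closed form *)

Section GeneratingPolynomial.
Variable R : realType.
Implicit Types (n m l k : nat) (rho s : R).

(** The coefficient of [x ^+ l * rho ^+ (m.+1 - l)] in [(rho + x) ^+ m * (rho - m%:R * x)], which is
    F_n(x) for m = n - 1. *)
Definition coefC m l : R := binz R m l%:Z - m%:R * binz R m (l%:Z - 1).

Lemma coefC0 m : coefC m 0 = 1.
Proof. by rewrite /coefC /binz /= bin0 mulr0 subr0. Qed.

Lemma coefCS m l : coefC m l.+1 = 'C(m, l.+1)%:R - m%:R * 'C(m, l)%:R.
Proof. by rewrite /coefC (_ : l.+1%:Z - 1 = l%:Z) //; lia. Qed.

Lemma coefC1 m : coefC m 1 = 0.
Proof. by rewrite coefCS bin1 bin0 mulr1 subrr. Qed.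

Lemma coefC_small m l : (m.+1 < l)%N -> coefC m l = 0.
Proof. by case: l => // l ml; rewrite coefCS !bin_small ?mulr0 ?subr0 //; lia. Qed.

(** [evenC] and [oddC] are E_n and O_n as functions of t = x^2. The odd part starts at index 3,
    since the factor x^3 is taken out of it. *)
Definition evenC n rho (t : R) : R :=
  \sum_(0 <= k < n./2.+1) t ^+ k * rho ^+ (n - 2 * k) * coefC n.-1 (2 * k).

Definition oddC n rho (t : R) : R :=
  \sum_(0 <= k < n.-1./2)
    t ^+ k * rho ^+ (n - 3 - 2 * k) * coefC n.-1 (2 * k + 3).

Lemma C_polyE n rho s2 s3 : C_poly n rho s2 s3 =
  3 * (-1) ^+ n / (2 * 6 ^+ n * n%:R) *
  (evenC n rho (24 * s2) - 288 * s3 * oddC n rho (24 * s2)).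
Proof.
rewrite /C_poly /evenC /oddC; congr (_ * (_ - _ * _)).
apply: eq_bigr => k _.
by rewrite /coefC (_ : (2 * k + 3)%:Z - 1 = (2 * k + 2)%:Z) //; lia.
Qed.

Lemma sum_even_odd (V : nmodType) (g : nat -> V) n :
  \sum_(0 <= l < n.*2) g l =
  \sum_(0 <= k < n) g (2 * k)%N + \sum_(0 <= k < n) g (2 * k + 1)%N.
Proof.
elim: n => [|n IHn]; first by rewrite !big_geq ?addr0.
rewrite doubleS !big_nat_recr //= IHn -!addrA mul2n addn1; congr (_ + _).
by rewrite addrCA.
Qed.

(** Allows sums to be padded with vanishing terms, so that [generating_even_odd] needs no case
    distinction on the parity of n. *)
Lemma sum_nat_trunc (V : nmodType) (g : nat -> V) n m : (m <= n)%N ->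
  (forall k, (m <= k)%N -> g k = 0) ->
  \sum_(0 <= k < n) g k = \sum_(0 <= k < m) g k.
Proof.
move=> mn g0; rewrite (big_cat_nat (n := m)) //= [X in _ + X]big_nat_cond.
rewrite [X in _ + X]big1 ?addr0 // => k /andP[/andP[mk _] _].
exact: g0.
Qed.

(** The binomial theorem, with the sum coming from [m%:R * x] shifted by one index. The morphism [f]
    will be the inclusion into the complex numbers for the closed form, and the identity for the
    warped metric. *)
Lemma generatingE (K : comNzRingType) (f : {rmorphism R -> K}) n rho (x : K) :
  (0 < n)%N -> (f rho + x) ^+ n.-1 * (f rho - n.-1%:R * x) =
  \sum_(0 <= l < n.+1) x ^+ l * f rho ^+ (n - l) * f (coefC n.-1 l).
Proof.
case: n => // m _ /=; rewrite mulrBr exprDn !mulr_suml big_mkord.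
(* The first sum receives the extra index [m.+1], where the binomial coefficient is zero; once its
   term of index 0 is split off, both sums have the same range. *)
transitivity (\sum_(i < m.+2) x ^+ i * f rho ^+ (m.+1 - i) * 'C(m, i)%:R
  - \sum_(i < m.+1) x ^+ i.+1 * f rho ^+ (m - i) * (m%:R * 'C(m, i)%:R)).
  congr (_ - _).
    rewrite [RHS]big_ord_recr /= bin_small // mulr0 addr0.
    apply: eq_bigr => i _; rewrite subSn; last by rewrite -ltnS.
    by rewrite -[X in X * _]mulr_natr exprS; ring.
  by apply: eq_bigr => i _; rewrite -[X in X * _]mulr_natr exprS; ring.
rewrite [X in X - _]big_ord_recl [RHS]big_ord_recl /= bin0 coefC0 rmorph1 -addrA.
congr (_ + _).
rewrite -sumrB; apply: eq_bigr => i _.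
rewrite /bump /= add1n coefCS rmorphB rmorphM !rmorph_nat subSS; ring.
Qed.

Lemma generating_even_odd (K : comNzRingType) (f : {rmorphism R -> K}) n rho t (x : K) :
  (0 < n)%N -> x ^+ 2 = f t ->
  (f rho + x) ^+ n.-1 * (f rho - n.-1%:R * x) =
  f (evenC n rho t) + x ^+ 3 * f (oddC n rho t).
Proof.
move=> n0 xt; rewrite generatingE //.
set g := fun l => x ^+ l * f rho ^+ (n - l) * f (coefC n.-1 l).
have g0 l : (n < l)%N -> g l = 0.
  by move=> nl; rewrite /g coefC_small ?rmorph0 ?mulr0 //; lia.
(* Pad to an even number of indices, split by parity, then cut each half back to the range used in
   its definition. *)
rewrite -(@sum_nat_trunc _ g n.+1.*2); [|lia|exact: g0].
rewrite sum_even_odd; congr (_ + _).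
  rewrite (@sum_nat_trunc _ _ _ n./2.+1); [|lia|by move=> k nk; apply: g0; lia].
  rewrite rmorph_sum; apply: eq_bigr => k _.
  by rewrite /g exprM xt !rmorphM !rmorphXn.
(* The term of index 1 vanishes by [coefC1]; all other odd indices are of the form 2k + 3, which
   yields the factor x^3. *)
rewrite big_nat_recl //= /g muln0 add0n coefC1 rmorph0 mulr0 add0r.
rewrite (@sum_nat_trunc _ _ _ n.-1./2); last 2 first.
- lia.
- by move=> k nk; rewrite coefC_small ?rmorph0 ?mulr0 //; lia.
rewrite rmorph_sum mulr_sumr; apply: eq_bigr => k _.
rewrite (_ : (2 * k.+1 + 1)%N = (2 * k + 3)%N); last lia.
rewrite (_ : (n - 3 - 2 * k)%N = (n - (2 * k + 3))%N); last lia.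
by rewrite exprD exprM xt !rmorphM !rmorphXn; ring.
Qed.

(** The two products are F_n(x) and F_n(-x), so the braces equal (E + x^3 O)(1 - y) + (E - x^3 O)(1
    + y) = 2 (E - y x^3 O), where y x^3 = 288 S_3. *)
Lemma closed_form (K : numClosedFieldType) (f : {rmorphism R -> K}) n rho s2 s3 :
  (0 < n)%N -> s2 != 0 ->
  let x := sqrtC (24 * f s2) in
  let y := sqrtC 6 * (f s3 / sqrtC (f s2) ^+ 3) in
  3 * (-1) ^+ n / (4 * 6 ^+ n * n%:R) *
  ((f rho + x) ^+ n.-1 * (f rho - n.-1%:R * x) * (1 - y)
   + (f rho - x) ^+ n.-1 * (f rho + n.-1%:R * x) * (1 + y)) =
  f (C_poly n rho s2 s3).
Proof.
move=> n0 s20; rewrite C_polyE.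
set s := sqrtC (f s2) => x y.
have s_neq0 : s != 0 by rewrite sqrtC_eq0 fmorph_eq0.
(* The principal square root is not multiplicative in general; it is here because the factor 24 is
   nonnegative, whatever the sign of S_2. *)
have xE : x = sqrtC 24 * s by rewrite /x rootCMl ?ler0n.
have xx : x ^+ 2 = f (24 * s2) by rewrite xE exprMn !sqrtCK rmorphM rmorph_nat.
have s246 : sqrtC 24 * sqrtC 6 = 12 :> K.
  rewrite -rootCMl ?ler0n // (_ : 24 * 6 = 12 ^+ 2); last by ring.
  by rewrite sqrCK ?ler0n.
(* The powers of [s] cancel, and sqrt 6 * (sqrt 24)^3 = 12 * 24 = 288. *)
have yx : y * x ^+ 3 = 288 * f s3.
  have -> : y * x ^+ 3 = (sqrtC 24 * sqrtC 6) * sqrtC 24 ^+ 2 * f s3.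
    by rewrite /y xE exprMn; field.
  by rewrite s246 sqrtCK; ring.
have F1 := generating_even_odd rho n0 xx.
have F2 : (f rho - x) ^+ n.-1 * (f rho + n.-1%:R * x) =
    f (evenC n rho (24 * s2)) - x ^+ 3 * f (oddC n rho (24 * s2)).
  have xx' : (- x) ^+ 2 = f (24 * s2) by rewrite sqrrN.
  have := generating_even_odd rho n0 xx'.
  by rewrite mulrN opprK => ->; ring.
rewrite F1 F2.
have fK : f (3 * (-1) ^+ n / (2 * 6 ^+ n * n%:R)) =
    3 * (-1) ^+ n / (2 * 6 ^+ n * n%:R) :> K.
  by rewrite fmorph_div !rmorphM !rmorphXn rmorphN1 !rmorph_nat.
have f288 : f (288 * s3) = y * x ^+ 3 by rewrite yx rmorphM rmorph_nat.
rewrite rmorphM rmorphB [f (288 * s3 * _)]rmorphM fK f288.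
have ny : n%:R != 0 :> K by rewrite pnatr_eq0 -lt0n.
have six : 6 ^+ n != 0 :> K by rewrite expf_neq0 // pnatr_eq0.
field.
by rewrite ny six.
Qed.

Lemma C_poly_closed n rho s2 s3 : (0 < n)%N -> s2 != 0 ->
  C_closed n rho s2 s3 = (C_poly n rho s2 s3)%:C.
Proof. exact: closed_form. Qed.

(** Under these relations E_n - 288 S_3 O_n is E_n(x^2) - x^3 O_n(x^2), the even-odd splitting of
    F_n(-x). There is no division by x, so x = 0 is included. *)
Lemma C_poly_square n rho s2 s3 (x : R) : (0 < n)%N ->
  24 * s2 = x ^+ 2 -> 288 * s3 = x ^+ 3 ->
  C_poly n rho s2 s3 = 3 * (-1) ^+ n / (2 * 6 ^+ n * n%:R) *
    ((rho - x) ^+ n.-1 * (rho + n.-1%:R * x)).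
Proof.
move=> n0 xx xxx; rewrite C_polyE xxx; congr (_ * _).
have := @generating_even_odd _ (idfun : R -> R) n rho (24 * s2) (- x) n0.
by rewrite sqrrN xx => /(_ erefl) /=; rewrite mulrN opprK => ->; ring.
Qed.

End GeneratingPolynomial.

(** * Polynomials of a given curvature order *)

Section Homogeneity.
Variable R : realType.
Implicit Types (n : nat) (f g : R -> R -> R -> R).

Lemma order_ext n f g : (forall rho s2 s3, f rho s2 s3 = g rho s2 s3) ->
  polynomial_of_order n f -> polynomial_of_order n g.
Proof. by move=> fg [c cE]; exists c => rho s2 s3; rewrite -fg. Qed.

Lemma order0 n : polynomial_of_order n (fun _ _ _ : R => 0).
Proof.
exists (fun _ _ _ => 0) => rho s2 s3.
by rewrite big1 // => i _; rewrite big1 // => j _; rewrite big1 // => k _; rewrite !mul0r.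
Qed.

Lemma orderD n f g : polynomial_of_order n f -> polynomial_of_order n g ->
  polynomial_of_order n (fun rho s2 s3 => f rho s2 s3 + g rho s2 s3).
Proof.
move=> [c cE] [d dE]; exists (fun i j k => c i j k + d i j k) => rho s2 s3.
rewrite cE dE -big_split; apply: eq_bigr => i _ /=.
rewrite -big_split; apply: eq_bigr => j _ /=.
by rewrite -big_split; apply: eq_bigr => k _ /=; rewrite !mulrDl.
Qed.

Lemma order_sum n a b (F : nat -> R -> R -> R -> R) :
  (forall k, (a <= k < b)%N -> polynomial_of_order n (F k)) ->
  polynomial_of_order n (fun rho s2 s3 => \sum_(a <= k < b) F k rho s2 s3).
Proof.
elim: b => [|b IHb] ordF.
  by apply: order_ext (order0 n) => rho s2 s3; rewrite big_geq.
have [ab|ba] := leqP a b; last first.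
  by apply: order_ext (order0 n) => rho s2 s3; rewrite big_geq.
have ordFb : polynomial_of_order n (F b) by apply: ordF; rewrite ab /=.
have ordFlt k : (a <= k < b)%N -> polynomial_of_order n (F k).
  by move=> /andP[ak kb]; apply: ordF; rewrite ak ltnW.
by apply: order_ext (orderD (IHb ordFlt) ordFb) => rho s2 s3; rewrite big_nat_recr.
Qed.

Lemma order_monomial n (c : R) i j k : (i + 2 * j + 3 * k = n)%N ->
  polynomial_of_order n (fun rho s2 s3 => c * rho ^+ i * s2 ^+ j * s3 ^+ k).
Proof.
move=> ijk.
have lt_i : (i < n.+1)%N by lia.
have lt_j : (j < n.+1)%N by lia.
have lt_k : (k < n.+1)%N by lia.
(* The coefficient family is supported at the single triple (i, j, k), and the three sums collapse
   to it one after the other. *)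
exists (fun i' j' k' => if [&& i' == i, j' == j & k' == k] then c else 0) => rho s2 s3.
rewrite (bigD1 (Ordinal lt_i)) //= [X in _ + X]big1 ?addr0; last first.
  move=> i' i'i; rewrite big1 // => j' _; rewrite big1 // => k' _.
  by rewrite (_ : (nat_of_ord i' == i) = false) ?mul0r //; apply: negbTE.
rewrite (bigD1 (Ordinal lt_j)) //= [X in _ + X]big1 ?addr0; last first.
  move=> j' j'j; rewrite big1 // => k' _.
  by rewrite (_ : (nat_of_ord j' == j) = false) ?andbF ?mul0r //; apply: negbTE.
rewrite (bigD1 (Ordinal lt_k)) ?ijk //= [X in _ + X]big1 ?addr0 ?eqxx //.
move=> k' /andP[_ k'k].
by rewrite (_ : (nat_of_ord k' == k) = false) ?andbF ?mul0r //; apply: negbTE.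
Qed.

(** The monomials are R^(n-2k) S_2^k and R^(n-3-2k) S_2^k S_3. On the ranges of summation 2k <= n
    and 2k + 3 <= n respectively, so the subtractions are exact and each monomial has order n. *)
Lemma C_poly_order n : (0 < n)%N -> polynomial_of_order n (@C_poly R n).
Proof.
move=> n0.
pose K : R := 3 * (-1) ^+ n / (2 * 6 ^+ n * n%:R).
have ordE k : (0 <= k < n./2.+1)%N -> polynomial_of_order n (fun rho s2 s3 : R =>
    K * 24 ^+ k * coefC R n.-1 (2 * k) * rho ^+ (n - 2 * k) * s2 ^+ k * s3 ^+ 0).
  by move=> kn; apply: order_monomial; lia.
have ordO k : (0 <= k < n.-1./2)%N -> polynomial_of_order n (fun rho s2 s3 : R =>
    - 288 * K * 24 ^+ k * coefC R n.-1 (2 * k + 3) *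
    rho ^+ (n - 3 - 2 * k) * s2 ^+ k * s3 ^+ 1).
  by move=> kn; apply: order_monomial; lia.
apply: order_ext (orderD (order_sum ordE) (order_sum ordO)) => rho s2 s3.
rewrite C_polyE -/K /evenC /oddC.
rewrite mulrBr [K * (288 * s3 * _)]mulrA 2!mulr_sumr -sumrN; congr (_ + _);
  by apply: eq_bigr => k _; rewrite exprMn; move: K {ordE ordO} => K; ring.
Qed.

(** Freezing R and S_3 leaves a polynomial in S_2 alone, to which [poly_eq_off0] applies in the
    proof of the recursion. *)
Lemma order_horner n f rho s3 : polynomial_of_order n f ->
  exists p : {poly R}, forall s2, f rho s2 s3 = p.[s2].
Proof.
move=> [c cE]; exists (\sum_(i < n.+1) \sum_(j < n.+1)
  \sum_(k < n.+1 | (i + 2 * j + 3 * k == n)%N)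
      (c i j k * rho ^+ i * s3 ^+ k) *: 'X^j) => s2.
rewrite cE horner_sum; apply: eq_bigr => i _.
rewrite horner_sum; apply: eq_bigr => j _.
rewrite horner_sum; apply: eq_bigr => k _.
by rewrite hornerZ hornerXn mulrAC.
Qed.

End Homogeneity.

(** * The recursion *)

Lemma poly_eq_off0 (R : numFieldType) (p q : {poly R}) :
  (forall x, x != 0 -> p.[x] = q.[x]) -> p = q.
Proof.
move=> pq; apply/eqP; rewrite -subr_eq0; apply/eqP.
(* The nonzero points 1, 2, ..., [size (p - q)] are distinct roots of [p - q], too many for a
   nonzero polynomial. *)
apply: (@roots_geq_poly_eq0 _ _ [seq i.+1%:R | i <- iota 0 (size (p - q))]).
- apply/allP => _ /mapP[i _ ->].
  by rewrite /root hornerD hornerN pq ?subrr // pnatr_eq0.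
- by rewrite map_inj_uniq ?iota_uniq // => i j /eqP; rewrite eqr_nat eqSS => /eqP.
- by rewrite size_map size_iota.
Qed.

(** In C 1 = - rho / 4 and C 2 = (rho^2 - x^2) / 48 the variable y cancels, so the recursion is
    linear in the parts carrying 1 - y and 1 + y, which x -> -x exchanges. Taking (rho + x)^(n-2)
    out of the first part leaves an identity between quadratic forms in rho and x. *)
Lemma closed_form_rec (K : numFieldType) (rho x y : K) n : (4 <= n)%N ->
  let C m := 3 * (-1) ^+ m / (4 * 6 ^+ m * m%:R) *
    ((rho + x) ^+ m.-1 * (rho - m.-1%:R * x) * (1 - y)
     + (rho - x) ^+ m.-1 * (rho + m.-1%:R * x) * (1 + y)) in
  C n = 4 * (n%:R - 1) * (n%:R - 2) / (3 * n%:R * (n%:R - 3)) *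
    (C (n - 1)%N * C 1%N - C (n - 2)%N * C 2%N).
Proof.
(* With n = m + 4 every subtraction computes, and all powers with exponent depending on n can be
   reduced to exponent m, which [field] treats as atoms. *)
case: n => [|[|[|[|m]]]] // _ C; rewrite /C !subSS !subn0 /=.
rewrite ![(rho + x) ^+ _.+1]exprS ![(rho - x) ^+ _.+1]exprS.
rewrite ![(-1) ^+ _.+1]exprS ![6 ^+ _.+1]exprS -!natr1.
(* The four denominators are n - 3, n - 2, n - 1 and n. *)
have m1 : m%:R + 1 != 0 :> K by rewrite natr1 pnatr_eq0.
have m2 : m%:R + 1 + 1 != 0 :> K by rewrite !natr1 pnatr_eq0.
have m3 : m%:R + 1 + 1 + 1 != 0 :> K by rewrite !natr1 pnatr_eq0.
have m4 : m%:R + 1 + 1 + 1 + 1 != 0 :> K by rewrite !natr1 pnatr_eq0.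
move: (m%:R) m1 m2 m3 m4 => M m1 m2 m3 m4.
rewrite !expr0 !mulr1; field.
rewrite (_ : M + 1 + 1 + 1 + 1 - 3 = M + 1); last by ring.
have six : 0 + 1 + 1 + 1 + 1 + 1 + 1 != 0 :> K.
  by rewrite (_ : 0 + 1 + 1 + 1 + 1 + 1 + 1 = 6) ?pnatr_eq0 //; ring.
by rewrite m1 m2 m3 m4 expf_neq0.
Qed.

Section Recursion.
Variable R : realType.
Implicit Types (n : nat) (rho s : R).

Lemma C_closed_rec n rho s2 s3 : (4 <= n)%N ->
  C_closed n rho s2 s3 =
    4 * (n%:R - 1) * (n%:R - 2) / (3 * n%:R * (n%:R - 3)) *
    (C_closed (n - 1) rho s2 s3 * C_closed 1 rho s2 s3
     - C_closed (n - 2) rho s2 s3 * C_closed 2 rho s2 s3).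
Proof. exact: closed_form_rec. Qed.

Lemma rmorph_rec (K : fieldType) (f : {rmorphism R -> K}) n A B C D :
  f (4 * (n%:R - 1) * (n%:R - 2) / (3 * n%:R * (n%:R - 3)) * (A * B - C * D)) =
  4 * (n%:R - 1) * (n%:R - 2) / (3 * n%:R * (n%:R - 3)) * (f A * f B - f C * f D).
Proof.
by rewrite rmorphM fmorph_div rmorphB !rmorphM !rmorphB rmorph1 !rmorph_nat.
Qed.

Lemma C_poly_rec n rho s2 s3 : (4 <= n)%N ->
  C_poly n rho s2 s3 =
    4 * (n%:R - 1) * (n%:R - 2) / (3 * n%:R * (n%:R - 3)) *
    (C_poly (n - 1) rho s2 s3 * C_poly 1 rho s2 s3
     - C_poly (n - 2) rho s2 s3 * C_poly 2 rho s2 s3).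
Proof.
move=> n4; set c := _ / _.
have polyC m : (0 < m)%N -> exists p : {poly R}, forall s2, C_poly m rho s2 s3 = p.[s2].
  by move=> /(C_poly_order R); exact: order_horner.
have [|pn pnE] := polyC n; first lia.
have [|p1 p1E] := polyC (n - 1)%N; first lia.
have [|p2 p2E] := polyC (n - 2)%N; first lia.
have [//|q1 q1E] := polyC 1%N; have [//|q2 q2E] := polyC 2%N.
(* As polynomials in S_2 the two sides need only be compared at S_2 != 0, where the closed form is
   available; injectivity of the inclusion into the complex numbers brings the identity back to the
   reals. *)
have pq : pn = c *: (p1 * q1 - p2 * q2).
  apply: poly_eq_off0 => x x0.
  rewrite hornerZ hornerD hornerN !hornerM -pnE -p1E -p2E -q1E -q2E.
  have closedE m : (0 < m)%N -> C_closed m rho x s3 = (C_poly m rho x s3)%:C.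
    by move=> m0; exact: C_poly_closed.
  have n0 : (0 < n)%N by lia.
  have n1 : (0 < n - 1)%N by lia.
  have n2 : (0 < n - 2)%N by lia.
  apply: (@complexI R).
  rewrite -(closedE _ n0) (C_closed_rec rho x s3 n4).
  rewrite (closedE _ n1) (closedE _ n2) (closedE 1%N isT) (closedE 2%N isT).
  exact/esym/rmorph_rec.
by rewrite pnE p1E p2E q1E q2E pq hornerZ hornerD hornerN !hornerM.
Qed.

Lemma C_poly1 rho s2 s3 : C_poly 1 rho s2 s3 = - rho / 4.
Proof.
rewrite C_polyE /evenC /oddC /= !big_nat1 !big_geq //= !muln0 coefC0.
by field.
Qed.

Lemma C_poly2 rho s2 s3 : C_poly 2 rho s2 s3 = rho ^+ 2 / 48 - s2 / 2.
Proof.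
rewrite C_polyE /evenC /oddC /= big_nat_recr // big_nat1 big_geq //= !muln0 muln1.
rewrite subn0 subnn coefC0 coefCS binn bin_small //.
by field.
Qed.

Lemma C_poly3 rho s2 s3 :
  C_poly 3 rho s2 s3 = - rho ^+ 3 / 432 + rho * s2 / 6 - 4 * s3 / 3.
Proof.
rewrite C_polyE /evenC /oddC /= big_nat_recr // !big_nat1 //= !muln0 muln1.
rewrite !subn0 subnn coefC0 !coefCS binn bin1 !bin_small //.
by field.
Qed.

End Recursion.

(** * Curvature of the warped metric *)

Section WarpedCurvature.
Variables (R : realType) (w : R -> R).
Implicit Types (p q : 'rV[R]_3) (a b c d : 'I_3) (s : R).

Lemma sum3 (V : nmodType) (F : 'I_3 -> V) :
  \sum_i F i = F (@Ordinal 3 0 isT) + F (@Ordinal 3 1 isT) + F (@Ordinal 3 2 isT).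
Proof.
rewrite !big_ord_recl big_ord0 addr0 addrA.
by congr (F _ + F _ + F _); apply: val_inj.
Qed.

(** Along the first coordinate both sides are limits of the same difference quotient; along the
    others the quotient is identically zero. *)
Lemma pderiv_coord0 (h : R -> R) a p :
  pderiv a (fun q => h (q 0 0)) p = (a == 0%N :> nat)%:R * derive1 h (p 0 0).
Proof.
rewrite /pderiv /derive /=; have [a0|a0] := eqVneq (a : nat) 0%N.
  rewrite mul1r /derive1; set f := (fun _ => _); set g := (fun _ => _).
  suff -> : f = g by [].
  apply/funext => e; rewrite /f /g /= !mxE.
  by rewrite (_ : a = 0) ?eqxx ?mulr1 //; apply: val_inj.
rewrite mul0r; apply: cvg_lim => //.
rewrite (_ : (fun _ => _) = cst 0); first exact: cvg_cst.
apply/funext => e /=; rewrite !mxE.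
rewrite (_ : (0 == a) = false) ?andbF ?mulr0 ?add0r ?subrr ?scaler0 //.
by apply/negbTE; rewrite eq_sym -val_eqE.
Qed.

Definition warp s : 'rV[R]_3 := \row_(i < 3) [:: 1; - w s ^+ 2; w s ^+ 2]`_i.

Definition warp_inv s : 'rV[R]_3 :=
  \row_(i < 3) [:: 1; - (w s)^-1 ^+ 2; (w s)^-1 ^+ 2]`_i.

Lemma warp_mulV s : w s != 0 -> diag_mx (warp s) *m diag_mx (warp_inv s) = 1%:M.
Proof.
move=> ws; rewrite mulmx_diag -diag_const_mx; congr diag_mx.
apply/rowP => -[[|[|[|//]]] i]; rewrite !mxE /= ?mulr1 // ?mulrNN -exprMn divff //.
all: by rewrite expr1n.
Qed.

Lemma invmx_warp s : w s != 0 -> invmx (diag_mx (warp s)) = diag_mx (warp_inv s).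
Proof.
move=> ws; have [u _] := mulmx1_unit (warp_mulV ws).
by rewrite -[LHS]mulmx1 -(warp_mulV ws) mulmxA mulVmx // mul1mx.
Qed.

Definition gamma c a b s : R :=
  2^-1 * \sum_d invmx (diag_mx (warp s)) c d *
    ((a == 0%N :> nat)%:R * derive1 (fun s => diag_mx (warp s) d b) s
     + (b == 0%N :> nat)%:R * derive1 (fun s => diag_mx (warp s) d a) s
     - (d == 0%N :> nat)%:R * derive1 (fun s => diag_mx (warp s) a b) s).

(** Equality as functions of the point, so that [pderiv_coord0] also applies to the derivatives of
    the Christoffel symbols in the Riemann tensor. *)
Lemma christoffel_warped c a b :
  christoffel (warped_metric w) c a b = fun p => gamma c a b (p 0 0).
Proof.
apply/funext => p; rewrite /christoffel /gamma; congr (_ * _).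
apply: eq_bigr => d _; congr (_ * _).
by congr (_ + _ - _); rewrite -pderiv_coord0.
Qed.

Lemma derive1_warp s a b : derivable w s 1 ->
  derive1 (fun s => diag_mx (warp s) a b) s =
  [:: 0; - (2 * (w s * derive1 w s)); 2 * (w s * derive1 w s)]`_a *+ (a == b).
Proof.
move=> dw.
have dw2 : is_derive s 1 (fun s => w s ^+ 2) (2 * (w s * derive1 w s)).
  have dw1 : is_derive s 1 w (derive1 w s) by rewrite derive1E; exact: derivableP.
  apply: is_derive_eq; rewrite /GRing.scale /=; ring.
rewrite derive1E; have [<-|ab] := eqVneq a b; last first.
  rewrite mulr0n (_ : (fun _ => _) = cst 0) ?derive_cst //.
  by apply/funext => t; rewrite !mxE (negbTE ab).
rewrite mulr1n (_ : (fun _ => _) = fun s => [:: 1; - w s ^+ 2; w s ^+ 2]`_a); last first.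
  by apply/funext => t; rewrite !mxE eqxx.
case: a => -[|[|[|//]]] i /=.
- by rewrite derive_cst.
- exact: derive_val.
- exact: derive_val.
Qed.

(** [coefL] selects the symbols Gamma^t_rt = Gamma^x_rx = w'/w, symmetric in the lower indices;
    [coefM] selects Gamma^r_tt = w w' and Gamma^r_xx = - w w'. *)
Definition coefL (c a b : nat) : R :=
  ((c != 0) && ((a == 0) && (c == b) || (b == 0) && (c == a)))%:R.

Definition coefM (c a b : nat) : R :=
  ((c == 0) && (a == b))%:R * [:: 0; 1; -1]`_a.

Lemma gammaE c a b s : w s != 0 -> derivable w s 1 ->
  gamma c a b s =
  coefL c a b * (derive1 w s / w s) + coefM c a b * (w s * derive1 w s).
Proof.
move=> ws dw; rewrite /gamma invmx_warp // sum3 !derive1_warp //.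
rewrite !mxE /coefL /coefM -!val_eqE.
move: (derive1 w s) => w'.
case: c => -[|[|[|//]]] ci; case: a => -[|[|[|//]]] ai;
  case: b => -[|[|[|//]]] bi /=; rewrite ?mulr0n ?mulr1n; by field.
Qed.

Variable r : R.
Hypotheses (wr : w r != 0) (dw : \forall s \near r, derivable w s 1)
  (ddw : derivable (derive1 w) r 1).

Let w' := derive1 w r.
Let w'' := derive1 (derive1 w) r.

Lemma derive1_gamma c a b : derive1 (gamma c a b) r =
  coefL c a b * ((w'' * w r - w' ^+ 2) / w r ^+ 2)
  + coefM c a b * (w' ^+ 2 + w r * w'').
Proof.
have dwr : derivable w r 1 by exact: nbhs_singleton dw.
have w_neq0 : \forall s \near r, w s != 0.
  have /differentiable_continuous cw : differentiable w r by apply/derivable1_diffP.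
  exact: cvgr_neq0 cw wr.
have dw1 : is_derive r 1 w w' by rewrite /w' derive1E; exact: (derivableP dwr).
have dw2 : is_derive r 1 (derive1 w) w''.
  by rewrite /w'' derive1E; exact: (derivableP ddw).
have dwV : is_derive r 1 (fun s => (w s)^-1) (- (w r) ^- 2 *: w').
  by apply: is_deriveV.
have dG : is_derive r 1 (fun s => coefL c a b * (derive1 w s / w s)
    + coefM c a b * (w s * derive1 w s))
    (coefL c a b * ((w'' * w r - w' ^+ 2) / w r ^+ 2)
     + coefM c a b * (w' ^+ 2 + w r * w'')).
  by apply: is_derive_eq; rewrite /GRing.scale /= -/w'; field.
rewrite -(@derive_val _ _ _ _ _ _ _ dG) derive1E.
(* [gammaE] holds only where w is nonzero and derivable. Both conditions hold near r, the first by
   continuity, and a derivative depends only on values near r. *)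
by apply: near_eq_derive; near=> s; apply: gammaE; near: s.
Unshelve. all: by end_near. Qed.

(** The eigenvalues of the mixed tensor R_a^b, not the components R_ab: [ricci_warped] multiplies
    them by the metric, which the inverse metric then cancels. *)
Definition warp_ricci : 'rV[R]_3 := \row_(i < 3)
  [:: - 2 * (w'' / w r); - (w'' / w r + (w' / w r) ^+ 2);
      - (w'' / w r + (w' / w r) ^+ 2)]`_i.

Variable p : 'rV[R]_3.
Hypothesis pr : p 0 0 = r.

Let Gam (c a b : nat) : R := coefL c a b * (w' / w r) + coefM c a b * (w r * w').

Let dGam (c a b : nat) : R := coefL c a b * ((w'' * w r - w' ^+ 2) / w r ^+ 2)
  + coefM c a b * (w' ^+ 2 + w r * w'').

Lemma riemann_warped c d a b : riemann (warped_metric w) c d a b p =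
  (a == 0%N :> nat)%:R * dGam c b d - (b == 0%N :> nat)%:R * dGam c a d
  + \sum_(e < 3) (Gam c a e * Gam e b d - Gam c b e * Gam e a d).
Proof.
have dwr : derivable w r 1 by exact: nbhs_singleton dw.
have chE i j k : christoffel (warped_metric w) i j k p = Gam i j k.
  by rewrite christoffel_warped pr gammaE.
have dchE i j k l : pderiv i (christoffel (warped_metric w) j k l) p =
    (i == 0%N :> nat)%:R * dGam j k l.
  by rewrite christoffel_warped pderiv_coord0 pr derive1_gamma.
rewrite /riemann !dchE; congr (_ + _).
by apply: eq_bigr => e _; rewrite !chE.
Qed.

Lemma ricci_warped :
  ricci (warped_metric w) p = diag_mx warp_ricci *m diag_mx (warp r).
Proof.
rewrite mulmx_diag; apply/matrixP => a b.
rewrite !mxE sum3 !riemann_warped !sum3 /Gam /dGam /coefL /coefM -val_eqE.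
move: w' w'' => y z.
case: a => -[|[|[|//]]] ai; case: b => -[|[|[|//]]] bi /=;
  rewrite ?mulr0n ?mulr1n; by field.
Qed.

Lemma mixed_warped : ricci (warped_metric w) p *m invmx (warped_metric w p) =
  diag_mx warp_ricci.
Proof.
have [u _] := mulmx1_unit (warp_mulV wr).
rewrite (_ : warped_metric w p = diag_mx (warp r)); last by rewrite /warp -pr.
by rewrite ricci_warped -mulmxA mulmxV // mulmx1.
Qed.

Lemma scalar_curvature_warped : scalar_curvature (warped_metric w) p =
  - 4 * (w'' / w r) - 2 * (w' / w r) ^+ 2.
Proof.
by rewrite /scalar_curvature mixed_warped mxtrace_diag sum3 !mxE /=; ring.
Qed.

Let u := (w' / w r) ^+ 2 - w'' / w r.

Lemma traceless_warped : mixed_traceless_ricci (warped_metric w) p =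
  diag_mx (\row_(i < 3) [:: 2 / 3 * u; - u / 3; - u / 3]`_i).
Proof.
have [g_unit _] := mulmx1_unit (warp_mulV wr).
rewrite /mixed_traceless_ricci /traceless_ricci mulmxBl mixed_warped -scalemxAl.
rewrite (_ : warped_metric w p = diag_mx (warp r)); last by rewrite /warp -pr.
rewrite mulmxV // scalar_curvature_warped /u; apply/matrixP => a b.
rewrite !mxE; have [->|_] := eqVneq a b; last by rewrite mulr0 subr0.
by case: b => -[|[|[|//]]] bi /=; rewrite !mulr1n; field.
Qed.

Lemma curvS2_warped : curvS2 (warped_metric w) p = 2 / 3 * u ^+ 2.
Proof.
rewrite /curvS2 traceless_warped !sum3 !mxE /= ?mulr0n ?mulr1n.
by field.
Qed.

Lemma curvS3_warped : curvS3 (warped_metric w) p = 2 / 9 * u ^+ 3.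
Proof.
rewrite /curvS3 traceless_warped !sum3 !mxE /= ?mulr0n ?mulr1n.
by field.
Qed.

Lemma C_poly_warped n : (0 < n)%N ->
  C_poly n (scalar_curvature (warped_metric w) p) (curvS2 (warped_metric w) p)
    (curvS3 (warped_metric w) p) =
  (w' / w r) ^+ (2 * (n - 1)) *
  (w'' / w r + (3 - 2 * n%:R) / (2 * n%:R) * (w' / w r) ^+ 2).
Proof.
(* Here x = 4u: 24 * (2/3) u^2 = (4u)^2 and 288 * (2/9) u^3 = (4u)^3. *)
move=> n0; rewrite (@C_poly_square _ _ _ _ _ (4 * u)) //; last 2 first.
- by rewrite curvS2_warped; field.
- by rewrite curvS3_warped; field.
rewrite scalar_curvature_warped /u exprM.
move: (w' / w r) (w'' / w r) => h A; move: (h ^+ 2) => {h} H.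
case: n n0 => // n _; rewrite subn1 /= [(-1) ^+ _]exprS [6 ^+ _]exprS.
(* R - x = - 6 H has no second derivative left: its power gives (a'/a)^(2(n-1)) and cancels the
   powers of 6 and the sign of the prefactor. *)
have -> : - 4 * A - 2 * H - 4 * (H - A) = (-1) * (6 * H) by ring.
rewrite exprMn [(6 * H) ^+ _]exprMn -[n.+1%:R]natr1.
have n_neq0 : n%:R + 1 != 0 :> R by rewrite natr1 pnatr_eq0.
have six : 6 ^+ n != 0 :> R by rewrite expf_neq0 // pnatr_eq0.
(* The left side contains the sign twice, as an atom for [field]; multiplying the right side by this
   square makes the two sides match. *)
have: (-1) ^+ n * (-1) ^+ n = 1 :> R by rewrite -exprMn mulrNN mulr1 expr1n.
move: (6 ^+ n) ((-1) ^+ n) (H ^+ n) six => S e P six ee.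
rewrite -[RHS]mul1r -[X in _ = X * _]ee; field.
by rewrite n_neq0 six.
Qed.

End WarpedCurvature.

Unset Implicit Arguments.
Set Strict Implicit.
Set Printing Implicit Defensive.

Theorem mainTheorem11 (R : realType) :
  (* (i) *)
  (forall n : nat, (1 <= n)%N ->
     polynomial_of_order n (@C_poly R n) /\
     (forall rho s2 s3 : R, s2 != 0 ->
        C_closed n rho s2 s3 = (C_poly n rho s2 s3)%:C)) /\
  (* (ii) *)
  (forall (n : nat) (a : R -> R) (p : 'rV[R]_3), (1 <= n)%N ->
     let g := warped_metric a in
     let r := p 0 0 in
     let v := (derive1 a r / a r) ^+ (2 * (n - 1)) *
              (derive1 (derive1 a) r / a r
               + (3 - 2 * n%:R) / (2 * n%:R) * (derive1 a r / a r) ^+ 2) in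
     a r != 0 ->
     (\forall s \near r, derivable a s 1) ->
     derivable (derive1 a) r 1 ->
     C_poly n (scalar_curvature g p) (curvS2 g p) (curvS3 g p) = v /\
     (curvS2 g p != 0 ->
      C_closed n (scalar_curvature g p) (curvS2 g p) (curvS3 g p) = v%:C)) /\
  (* (iii) *)
  (forall rho s2 s3 : R,
     (forall n : nat, (4 <= n)%N ->
        C_poly n rho s2 s3 =
          4 * (n%:R - 1) * (n%:R - 2) / (3 * n%:R * (n%:R - 3)) *
          (C_poly (n - 1) rho s2 s3 * C_poly 1 rho s2 s3
           - C_poly (n - 2) rho s2 s3 * C_poly 2 rho s2 s3)) /\
     (forall n : nat, (4 <= n)%N -> s2 != 0 ->
        C_closed n rho s2 s3 =
          4 * (n%:R - 1) * (n%:R - 2) / (3 * n%:R * (n%:R - 3)) *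
          (C_closed (n - 1) rho s2 s3 * C_closed 1 rho s2 s3
           - C_closed (n - 2) rho s2 s3 * C_closed 2 rho s2 s3)) /\
     C_poly 1 rho s2 s3 = - rho / 4 /\
     C_poly 2 rho s2 s3 = rho ^+ 2 / 48 - s2 / 2 /\
     C_poly 3 rho s2 s3 = - rho ^+ 3 / 432 + rho * s2 / 6 - 4 * s3 / 3).
Proof.
split=> [n n0|].
  by split=> [|rho s2 s3 s20]; [exact: C_poly_order|exact: C_poly_closed].
split=> [n a p n0 g r v ar da dda|rho s2 s3].
  have polyE : C_poly n (scalar_curvature g p) (curvS2 g p) (curvS3 g p) = v.
    exact: (C_poly_warped ar da dda erefl n0).
  by split=> // s20; rewrite -polyE; exact: C_poly_closed.
split; first by move=> n; exact: C_poly_rec.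
split; first by move=> n n4 _; exact: C_closed_rec.
by rewrite C_poly1 C_poly2 C_poly3.
Qed.
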